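(* Let $m$ and $n$ be nonnegative integers with $m\le n$. Then $$\sum_{k=0}^n \frac{2^{-2k}C_k}{\prod_{j=1}^m\bigl(2(k-j)+1\bigr)} = \frac{2^{m+2}}{(m+2)!}\,\frac{(-1)^m}{C_{m+1}} - \frac{\bigl(2(n-m)+1\bigr)2^{m-2n}}{m!\,(2m+1)\binom{n+1}{m}}\,C_{n-m}.$$
   Context: $C_n=\frac{1}{n+1}\binom{2n}{n}$, $n\ge 0$, are the Catalan numbers. Empty products equal $1$. *)

(* Defs.v *)
From mathcomp Require Import all_boot all_order all_algebra.
Set Implicit Arguments.
Unset Strict Implicit.
Unset Printing Implicit Defensive.
Import GRing.Theory Num.Theory.
Local Open Scope ring_scope.

(* Division takes place in rat, so no integrality is presupposed. *)
Definition catalan (n : nat) : rat := n.+1%:R^-1 * 'C(2 * n, n)%:R.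

(* Main.v *)
Require Import Defs.
From mathcomp Require Import all_boot all_order all_algebra.
From mathcomp Require Import ring.
Set Implicit Arguments.
Unset Strict Implicit.
Unset Printing Implicit Defensive.
Import GRing.Theory Num.Theory.
Local Open Scope ring_scope.

(** The summand a_k is Gosper-summable: with R k = a_k (2(k-m)+1) / (2m+1) one
    has R (k-1) - R k = a_k, so the partial sums are A - R n with A = a_0 + R 0,
    for every n.  The condition m <= n is needed only to rewrite a_n in terms
    of C_(n-m) and the binomial coefficient. *)

(** Up to the factor 2^m this is the falling factorial of k - 1/2 of length m. *)
Definition odd_prod (m k : nat) : rat :=
  \prod_(1 <= j < m.+1) (2 * (k%:R - j%:R) + 1).

(** Parity: an odd natural minus an even one. Subtraction is in [rat], so a < b is covered and all
    denominators are nonzero. *)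
Lemma odd_diff_neq0 (a b : nat) : 2 * (a%:R - b%:R) + 1 != 0 :> rat.
Proof.
have -> : 2 * (a%:R - b%:R) + 1 = (2 * a).+1%:R - (2 * b)%:R :> rat.
  by rewrite -natr1 !natrM; ring.
rewrite subr_eq0 eqr_nat; apply/eqP => /(congr1 odd).
by rewrite /= !oddM.
Qed.

Lemma odd_prod0 (k : nat) : odd_prod 0 k = 1.
Proof. by rewrite /odd_prod big_geq. Qed.

Lemma odd_prodS (m k : nat) :
  odd_prod m.+1 k = odd_prod m k * (2 * (k%:R - m.+1%:R) + 1).
Proof. by rewrite /odd_prod big_nat_recr. Qed.

Lemma odd_prod_neq0 (m k : nat) : odd_prod m k != 0.
Proof.
elim: m => [|m IHm]; first by rewrite odd_prod0 oner_neq0.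
by rewrite odd_prodS mulf_neq0 // odd_diff_neq0.
Qed.

(** The two products run over m consecutive odd numbers, from 2k+1 and from 2k-1 downwards; only the
    end factors differ. *)
Lemma odd_prod_shift (m k : nat) :
  odd_prod m k.+1 * (2 * (k%:R - m%:R) + 1) = odd_prod m k * (2 * k%:R + 1).
Proof.
elim: m => [|m IHm]; first by rewrite !odd_prod0; ring.
rewrite !odd_prodS -[k.+1%:R]natr1 -[m.+1%:R]natr1.
transitivity (odd_prod m k.+1 * (2 * (k%:R - m%:R) + 1)
              * (2 * (k%:R - (m%:R + 1)) + 1)); first by ring.
by rewrite IHm; ring.
Qed.

Lemma odd_prodSS (m k : nat) :
  odd_prod m.+1 k.+1 = odd_prod m k * (2 * k%:R + 1).
Proof.
rewrite odd_prodS -odd_prod_shift -[k.+1%:R]natr1 -[m.+1%:R]natr1; ring.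
Qed.

Lemma catalan_neq0 (n : nat) : catalan n != 0.
Proof.
rewrite mulf_neq0 ?invr_eq0 ?pnatr_eq0 // -lt0n bin_gt0.
by rewrite leq_pmull.
Qed.

Lemma catalan0 : catalan 0 = 1.
Proof. by []. Qed.

Lemma catalanS (n : nat) :
  catalan n.+1 * (n%:R + 2) = 2 * (2 * n%:R + 1) * catalan n.
Proof.
have n1_neq0 : n%:R + 1 != 0 :> rat by rewrite natr1 pnatr_eq0.
have n2_neq0 : n%:R + 2 != 0 :> rat by rewrite -natrD pnatr_eq0 addn2.
(* The two central binomials are compared through ['C((2 * n).+1, n)]. *)
have top : 2 * ((n%:R + 1) * 'C((2 * n).+1, n)%:R)
    = (n%:R + 1) * 'C(2 * n.+1, n.+1)%:R :> rat.
  by rewrite natr1 -!natrM -mul_bin_diag mulnS /= mulnA mulnS.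
have bot : (2 * n%:R + 1) * 'C(2 * n, n)%:R
    = (n%:R + 1) * 'C((2 * n).+1, n)%:R :> rat.
  rewrite -natrM !natr1 -!natrM; congr _%:R.
  by rewrite (mul_bin_down (2 * n).+1 n) subSn ?leq_pmull // mul2n -addnn addnK.
rewrite /catalan -[n.+2%:R]natr1 -[n.+1%:R]natr1.
have -> : 'C(2 * n.+1, n.+1)%:R = 2 * 'C((2 * n).+1, n)%:R :> rat.
  by apply: (mulfI n1_neq0); rewrite -top; ring.
have -> : 'C((2 * n).+1, n)%:R
    = (n%:R + 1)^-1 * ((2 * n%:R + 1) * 'C(2 * n, n)%:R) :> rat.
  by rewrite bot mulKf.
field.
by rewrite n1_neq0 -addrA n2_neq0.
Qed.

Lemma sum_catalan_odd_prod (m n : nat) :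
  \sum_(0 <= k < n.+1) (2 ^- (2 * k) * catalan k / odd_prod m k) =
  2 / ((2 * m%:R + 1) * odd_prod m 0)
  - 2 ^- (2 * n) * catalan n / odd_prod m n
    * (2 * (n%:R - m%:R) + 1) / (2 * m%:R + 1).
Proof.
have m_neq0 : 2 * m%:R + 1 != 0 :> rat by rewrite -natrM natr1 pnatr_eq0.
elim: n => [|n IHn].
  (* The constant comes from 1 + (1-2m)/(2m+1) = 2/(2m+1). *)
  rewrite big_nat1 catalan0 muln0 expr0.
  by field; rewrite odd_prod_neq0 m_neq0.
have n2_neq0 : n%:R + 2 != 0 :> rat by rewrite -natrD pnatr_eq0 addn2.
have n_neq0 : 2 * n%:R + 1 != 0 :> rat by rewrite -natrM natr1 pnatr_eq0.
rewrite big_nat_recr //= {}IHn mulnS exprD.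
(* The factor 2n+1 cancels between the two ratios below, so a_(n+1)/a_n = (2(n-m)+1)/(2(n+2)). *)
have -> : catalan n.+1 = 2 * (2 * n%:R + 1) * catalan n / (n%:R + 2).
  by rewrite -catalanS mulfK.
have -> : odd_prod m n.+1
    = odd_prod m n * (2 * n%:R + 1) / (2 * (n%:R - m%:R) + 1).
  by rewrite -odd_prod_shift mulfK // odd_diff_neq0.
rewrite -[n.+1%:R]natr1.
field.
rewrite !odd_prod_neq0 m_neq0 n2_neq0 n_neq0 odd_diff_neq0.
by rewrite expf_neq0.
Qed.

(** Both sides equal 2(-1)^m/(2m+1)!!, since the factors at k = 0 are -1, -3, ..., -(2m-1). The
    induction checks that each side gains -1/(2m+3). *)
Lemma odd_prod_at0 (m : nat) :
  2 / ((2 * m%:R + 1) * odd_prod m 0)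
  = 2 ^+ (m + 2) / (m + 2)`!%:R * ((- 1) ^+ m / catalan m.+1).
Proof.
elim: m => [|m IHm]; first by rewrite odd_prod0; apply/eqP.
have m3_neq0 : m%:R + 3 != 0 :> rat by rewrite -natrD pnatr_eq0 addn3.
have odd1_neq0 : 2 * m%:R + 1 != 0 :> rat by rewrite -natrM natr1 pnatr_eq0.
have odd3_neq0 : 2 * m%:R + 3 != 0 :> rat.
  by rewrite -natrM -natrD pnatr_eq0 addn3.
have -> : 2 / ((2 * m.+1%:R + 1) * odd_prod m.+1 0)
    = 2 / ((2 * m%:R + 1) * odd_prod m 0) * (- 1 / (2 * m%:R + 3)) :> rat.
  rewrite odd_prodS -[m.+1%:R]natr1.
  field; rewrite odd_prod_neq0 odd1_neq0 odd3_neq0 /=.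
  by have := odd_diff_neq0 0 m.+1; rewrite -[m.+1%:R]natr1 sub0r.
rewrite {}IHm !addSn factS natrM !exprS.
have -> : (m + 2).+1%:R = m%:R + 3 :> rat by rewrite -addnS natrD.
have -> : catalan m.+2 = 2 * (2 * m%:R + 3) * catalan m.+1 / (m%:R + 3).
  have := catalanS m.+1; rewrite -[m.+1%:R]natr1.
  have -> : m%:R + 1 + 2 = m%:R + 3 :> rat by ring.
  have -> : 2 * (m%:R + 1) + 1 = 2 * m%:R + 3 :> rat by ring.
  by move=> <-; rewrite mulfK.
field.
by rewrite catalan_neq0 m3_neq0 odd3_neq0 pnatr_eq0 -lt0n fact_gt0.
Qed.

(** This is [catalanS] iterated from C_d to C_(d+m): the factors i+2 form the falling factorial, the
    factors 2i+1 form [odd_prod]. Using d + m avoids truncated subtraction. *)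
Lemma catalan_ffact (d m : nat) :
  catalan (d + m) * ((d + m).+1 ^_ m)%:R
  = 2 ^+ m * catalan d * odd_prod m (d + m).
Proof.
elim: m => [|m IHm]; first by rewrite addn0 ffactn0 odd_prod0 expr0; ring.
rewrite addnS ffactSS natrM mulrA -[_.+2%:R]natr1 -[_.+1%:R]natr1.
have := catalanS (d + m).
have -> : (d + m)%:R + 2 = (d + m)%:R + 1 + 1 :> rat by ring.
move=> ->; rewrite odd_prodSS exprS -mulrA IHm; ring.
Qed.

Theorem proposition1 (m n : nat) (hmn : (m <= n)%N) :
  \sum_(0 <= k < n.+1)
     (2 ^- (2 * k) * catalan k
        / \prod_(1 <= j < m.+1) (2 * (k%:R - j%:R) + 1)) =
  2 ^+ (m + 2) / (m + 2)`!%:R * ((- 1) ^+ m / catalan m.+1)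
  - ((2 * (n%:R - m%:R) + 1) * 2 ^ (m%:Z - (2 * n)%:Z))
      / (m`!%:R * (2 * m%:R + 1) * 'C(n.+1, m)%:R) * catalan (n - m) :> rat.
Proof.
have m_neq0 : 2 * m%:R + 1 != 0 :> rat by rewrite -natrM natr1 pnatr_eq0.
have fact_neq0 : m`!%:R != 0 :> rat by rewrite pnatr_eq0 -lt0n fact_gt0.
have bin_neq0 : 'C(n.+1, m)%:R != 0 :> rat.
  by rewrite pnatr_eq0 -lt0n bin_gt0 leqW.
(* Take d = n-m in [catalan_ffact]; binomial times m! is the falling factorial. *)
have key : catalan n * ('C(n.+1, m)%:R * m`!%:R)
    = 2 ^+ m * catalan (n - m) * odd_prod m n.
  by rewrite -natrM bin_ffact; have := catalan_ffact (n - m) m; rewrite subnK.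
have catE : catalan n = 2 ^+ m * catalan (n - m) * odd_prod m n
    / ('C(n.+1, m)%:R * m`!%:R).
  by rewrite -key mulfK // mulf_neq0.
rewrite (sum_catalan_odd_prod m n) odd_prod_at0; congr (_ - _).
(* Eliminating C_n cancels [odd_prod m n]; the integer power splits into 2^m and 2^(-2n). *)
rewrite catE expfzDr // -exprnN -exprnP.
field.
by rewrite odd_prod_neq0 m_neq0 fact_neq0 bin_neq0 expf_neq0.
Qed.
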